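(* Let $\xi(x)$ be any real-valued function that tends to infinity as $x\to\infty$. For each fixed $\epsilon>0$, and almost all primes $p$, we have $L(p) > p^{1-\epsilon}$, where $L(p)$ is the maximum multiplicative order modulo $p$ of any of the integers $1,2,3,\dots,\lfloor \xi(p)\rfloor$.
   Context: A statement holds for almost all primes $p$ if, as $x\to\infty$, the number of primes $p\le x$ for which it fails is $o(x/\log x)$. In the definition of $L(p)$, the maximum is over those of the listed integers that are not divisible by $p$. *)

(* Defs.v *)
From mathcomp Require Export all_boot all_order all_algebra all_fingroup.
From mathcomp Require Export all_classical all_reals all_analysis.
Set Implicit Arguments.
Unset Strict Implicit.
Unset Printing Implicit Defensive.
Export Order.TTheory GRing.Theory Num.Theory.
Export numFieldNormedType.Exports.
Local Open Scope classical_set_scope.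
Local Open Scope ring_scope.

Section Definitions.
Variable R : realType.

(* Lets the Landau notations be used at +oo. *)
Canonical pinfty_filter_on : filter_on R := FilterType (pinfty_nbhs R) _.

Definition exceptions (P : pred nat) (x : R) : nat :=
  (\sum_(p < (Num.truncn x).+1 | prime p && ~~ P p) 1)%N.

Definition almost_all_primes (P : pred nat) : Prop :=
  (fun x : R => (exceptions P x)%:R : R) =o_+oo (fun x : R => x / ln x).

(* For prime p this is the multiplicative order of a modulo p when p does not
   divide a; the default value 1 of insubd is only reached when p divides a. *)
Definition mult_order (p a : nat) : nat :=
  #[insubd (1%g : {unit 'F_p}) (a%:R : 'F_p)]%g.

(* Num.truncn y is the floor of y when 0 <= y, and 0 otherwise, so that the
   range is always the set of positive integers up to the floor of y.  The
   maximum over an empty range is 0. *)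
Definition max_order (y : R) (p : nat) : nat :=
  (\max_(1 <= a < (Num.truncn y).+1 | ~~ (p %| a)) mult_order p a)%N.

End Definitions.

(* Main.v *)
Require Import Defs.
From mathcomp Require Import cyclic zify ring lra.
Local Open Scope classical_set_scope.
Local Open Scope ring_scope.

(** Fix distinct primes q_1, ..., q_s with s epsilon >= 2, and set N = s ^ 2.
    If p is large, every product of powers of the q_i with exponents below N is
    at most xi(p), so it suffices that one of these boundedly many products has
    order above p ^ (1 - epsilon) modulo p.

    The orders of such products are controlled by H, the lcm of the orders of
    the q_i.  In an abelian group, among g, g h, ..., g h ^ (N - 1) some element
    has order at least a constant times L ^ (1 - 1 / N), where L is the lcm of
    the orders of g and h ([exists_order_mul_expg]).  Bringing in the q_i one
    after the other ([exists_order_prodg]) gives a product a of order o with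
    H ^ N <= o ^ N (A H) ^ s, that is H ^ (s - 1) <= A o ^ s, for a constant A.
    If p is exceptional then o ^ s <= p ^ (s - 2), and hence
    H ^ s <= A p ^ (s - 1) ([exists_group_exponent]).

    So the group generated by the q_i modulo an exceptional p <= x has only
    O(x ^ (1 - 1 / s)) elements.  Two of the m ^ s products of the q_i with
    exponents below m coincide modulo p as soon as m ^ s > H, so that p divides
    the difference of two distinct integers built from an exponent vector with
    entries below m in absolute value.  There are at most (2 m) ^ s such
    vectors, each difference has O(m) prime divisors, and m can be taken
    of size x ^ ((s - 1) / s ^ 2).  The number of exceptional primes up to x is
    therefore O(m ^ (s + 1)) = O(x ^ (1 - 1 / N)) ([card_small_orders]), which
    is o(x / ln x) ([littleo_of_power_saving]). *)

(** * Orders of products in commuting families *)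

Section GroupOrders.
Local Open Scope nat_scope.

Lemma gcdnMl_dvd (a b m : nat) : gcdn (a * b) m %| gcdn a m * gcdn b m.
Proof.
have eM := dvdn_gcdl (a * b) m; have em := dvdn_gcdr (a * b) m.
set e := gcdn (a * b) m in eM em *; rewrite muln_gcdl dvdn_gcd.
by rewrite muln_gcdr dvdn_gcd eM (dvdn_mull _ em) dvdn_mulr.
Qed.

(** The gcd distributes over products up to divisibility, and the lcm divides
    the product. *)
Lemma gcdn_biglcmn_dvd (n m : nat) (D F : nat -> nat) :
  (forall i, i < n -> gcdn (D i) m %| F i) ->
  gcdn (\big[lcmn/1]_(i < n) D i) m %| \prod_(i < n) F i.
Proof.
elim: n => [|n IHn] DF; first by rewrite !big_ord0 gcd1n.
rewrite !big_ord_recr /=.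
apply: (@dvdn_trans (gcdn ((\big[lcmn/1]_(i < n) D i) * D n) m)).
  rewrite dvdn_gcd dvdn_gcdr andbT (dvdn_trans (dvdn_gcdl _ _)) //.
  by rewrite dvdn_lcm dvdn_mulr ?dvdn_mull.
apply: (dvdn_trans (gcdnMl_dvd _ _ _)).
by rewrite dvdn_mul ?DF // IHn // => i /ltnW; apply: DF.
Qed.

(** A product exceeds the lcm only through common factors.  When the n-th term
    is added, the loss is its gcd with the earlier lcm, which divides
    (n - 0) (n - 1) ... (n - (n - 1)) = n factorial. *)
Lemma prodn_dvd_biglcmn (n : nat) (D : nat -> nat) :
  (forall i j, i < j < n -> gcdn (D i) (D j) %| j - i) ->
  \prod_(i < n) D i %| (\big[lcmn/1]_(i < n) D i) * \prod_(j < n) j`!.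
Proof.
elim: n => [|n IHn] Dgcd; first by rewrite !big_ord0.
rewrite !big_ord_recr /=; set M := \big[lcmn/1]_(i < n) D i.
set A := \prod_(i < n) i`!.
have gMD : gcdn M (D n) %| n`!.
  have -> : n`! = \prod_(i < n) (n - i).
    rewrite fact_prod big_add1 big_mkord (reindex_inj rev_ord_inj) /=.
    by apply: eq_bigr => i _; rewrite subnSK.
  apply: (@gcdn_biglcmn_dvd n (D n) D (fun i => n - i)) => i ltin.
  by apply: Dgcd; rewrite ltin /=.
apply: (@dvdn_trans (M * A * D n)).
  rewrite dvdn_mul // IHn // => i j /andP[ij jn].
  by apply: Dgcd; rewrite ij ltnW.
rewrite mulnAC -(muln_lcm_gcd M) [A * _]mulnC mulnA.
by rewrite dvdn_mul ?dvdn_mul.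
Qed.

(** The cofactors D_t = L / #[g h ^ t] are nearly coprime.  If d divides both
    D_i and D_j, then g h ^ i and g h ^ j have trivial powers of exponent
    e = L / d, hence h and then g have trivial powers of exponent (j - i) e;
    thus L = e d divides (j - i) e and d divides j - i.  The product of the D_t is then at most a constant times L,
    so the product of the N orders is at least a constant times L ^ (N - 1), and
    the largest of them obeys the bound. *)
Lemma exists_order_mul_expg (gT : finGroupType) (g h : gT) (N : nat) :
  commute g h -> 0 < N -> let L := lcmn #[g]%g #[h]%g in
  exists2 t, t < N &
    L ^ N <= #[(g * h ^+ t)%g]%g ^ N * ((\prod_(j < N) j`!) * L).
Proof.
move=> cgh N0 L; pose o t := #[(g * h ^+ t)%g]%g.
have L0 : 0 < L by rewrite lcmn_gt0 !order_gt0.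
have expE t e : ((g * h ^+ t) ^+ e = g ^+ e * h ^+ (t * e)%N)%g.
  by rewrite expgMn ?expgM //; apply: commuteX.
have oL t : o t %| L.
  rewrite order_dvdn expE.
  have /eqP -> : (g ^+ L == 1)%g by rewrite -order_dvdn dvdn_lcml.
  by rewrite mul1g -order_dvdn dvdn_mull // dvdn_lcmr.
pose D t := L %/ o t.
have DL t : D t %| L by apply: dvdn_div; apply: oL.
have oD t : o t * D t = L by rewrite mulnC divnK.
have key : \prod_(i < N) D i <= (\prod_(j < N) j`!) * L.
  apply: dvdn_leq.
    by rewrite muln_gt0 L0 andbT prodn_gt0 // => i; rewrite fact_gt0.
  apply: (@dvdn_trans ((\big[lcmn/1]_(i < N) D i) * \prod_(j < N) j`!)).
    apply: prodn_dvd_biglcmn => i j /andP[ij jN]; set d := gcdn _ _.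
    have dL : d %| L by apply: dvdn_trans (dvdn_gcdl _ _) (DL i).
    pose e := L %/ d; have ed : e * d = L by rewrite divnK.
    have d0 : 0 < d by apply: dvdn_gt0 dL.
    have e0 : 0 < e by rewrite divn_gt0 // dvdn_leq.
    have oe k : d %| D k -> (g ^+ e * h ^+ (k * e)%N = 1)%g.
      move=> dk; rewrite -expE; apply/eqP; rewrite -order_dvdn -/(o k).
      by rewrite -(dvdn_pmul2r d0) ed -(oD k) dvdn_mul.
    have ei := oe _ (dvdn_gcdl _ _); have ej := oe _ (dvdn_gcdr _ _).
    have hij : (h ^+ ((j - i) * e)%N = 1)%g.
      apply: (mulgI (g ^+ e * h ^+ (i * e)%N)%g).
      by rewrite -mulgA -expgD -mulnDl subnKC ?(ltnW ij) // ej ei mulg1.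
    have gij : (g ^+ ((j - i) * e)%N = 1)%g.
      have hX k : (h ^+ (k * e * (j - i))%N = 1)%g.
        by rewrite -mulnA [e * _]mulnC mulnC expgM hij expg1n.
      rewrite mulnC expgM; have := congr1 (fun x => x ^+ (j - i)%N)%g ei.
      rewrite expgMn; last by apply: commuteX2.
      by rewrite -[in X in (_ * X)%g]expgM hX mulg1 expg1n.
    have: L %| (j - i) * e.
      by rewrite dvdn_lcm !order_dvdn gij hij eqxx.
    by rewrite -ed mulnC dvdn_pmul2r.
  by rewrite mulnC dvdn_mul //; apply/dvdn_biglcmP.
pose t := [arg max_(t > Ordinal N0) o t].
exists t => //; rewrite -/(o t).
have -> : L ^ N = \prod_(i < N) o i * \prod_(i < N) D i.
  by rewrite -big_split /= (eq_bigr (fun=> L)) // prod_nat_const card_ord.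
apply: leq_mul => //.
have -> : o t ^ N = \prod_(i < N) o t by rewrite prod_nat_const card_ord.
apply: leq_prod => i _; rewrite /t; case: arg_maxnP => // k _; exact.
Qed.

(** The factors are multiplied in one at a time, the exponent of each being given
    by the two-element case.  The comparison of the lcm with the order of the
    partial product loses a factor A H at each step, because adjoining x_k
    multiplies the lcm of the orders by at most L / #[a], where a is the partial
    product and L the lcm of #[a] and #[x_k]. *)
Lemma exists_order_prodg (gT : finGroupType) (x : nat -> gT) (N r : nat) :
  (forall g h : gT, commute g h) -> 0 < N ->
  let H := \big[lcmn/1]_(i < r) #[x i]%g in
  exists2 e : nat -> nat, forall i, e i < N &
    H ^ N <= #[(\prod_(i < r) x i ^+ e i)%g]%g ^ N
             * ((\prod_(j < N) j`!) * H) ^ r.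
Proof.
move=> cg N0 H; set A := \prod_(j < N) j`!.
pose Hk k := \big[lcmn/1]_(i < k) #[x i]%g.
have Hk0 k : 0 < Hk k.
  by apply: (big_ind (fun m => 0 < m)) => // a b; rewrite lcmn_gt0 => -> ->.
have HkS k : Hk k.+1 = lcmn (Hk k) #[x k]%g by rewrite /Hk big_ord_recr.
suff claim k : Hk k %| H -> exists2 e : nat -> nat, forall i, e i < N &
    (#[(\prod_(i < k) x i ^+ e i)%g]%g %| Hk k) &&
    (Hk k ^ N <= #[(\prod_(i < k) x i ^+ e i)%g]%g ^ N * (A * H) ^ k).
  have [e eN /andP[_ He]] := claim r (dvdnn _); by exists e.
elim: k => [|k IHk] HkH.
  by exists (fun=> 0) => //; rewrite /Hk !big_ord0 order1 expn0 muln1 exp1n.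
have /IHk[e eN /andP[]] : Hk k %| H.
  by apply: dvdn_trans HkH; rewrite HkS dvdn_lcml.
set a := (\prod_(i < k) x i ^+ e i)%g => aH IH.
have [t tN] := @exists_order_mul_expg _ _ _ N (cg a (x k)) N0.
set L := lcmn _ _; set b := (a * x k ^+ t)%g => Lb.
exists (fun i => if i == k then t else e i) => [i|]; first by case: eqP.
rewrite big_ord_recr /= eqxx.
have -> : (\prod_(i < k) x i ^+ (if i == k :> nat then t else e i) = a)%g.
  by apply: eq_bigr => i _; rewrite ltn_eqF.
have LHk : L %| Hk k.+1.
  by rewrite HkS dvdn_lcm dvdn_lcmr andbT (dvdn_trans aH) ?dvdn_lcml.
have H0 : 0 < H by exact: Hk0.
apply/andP; split.
  apply: dvdn_trans LHk; rewrite order_dvdn expgMn; last exact: cg.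
  have /eqP -> : (a ^+ L == 1)%g by rewrite -order_dvdn dvdn_lcml.
  rewrite mul1g -expgM mulnC expgM.
  have /eqP -> : (x k ^+ L == 1)%g by rewrite -order_dvdn dvdn_lcmr.
  by rewrite expg1n.
have HkL : Hk k.+1 * #[a]%g <= Hk k * L.
  have [c Hc] := dvdnP aH.
  have L0 : 0 < L by rewrite lcmn_gt0 !order_gt0.
  rewrite Hc mulnAC leq_pmul2r ?order_gt0 // dvdn_leq //.
    by rewrite muln_gt0 L0 andbT; move: (Hk0 k); rewrite Hc muln_gt0 => /andP[].
  rewrite HkS dvdn_lcm Hc dvdn_mul ?dvdn_lcml //=.
  by rewrite dvdn_mull ?dvdn_lcmr.
have aN0 : 0 < #[a]%g ^ N by rewrite expn_gt0 order_gt0.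
rewrite -(leq_pmul2r aN0) -expnMn.
apply: (@leq_trans ((Hk k * L) ^ N)); first by rewrite leq_exp2r.
have LleH : L <= H by rewrite dvdn_leq // (dvdn_trans LHk).
rewrite expnMn; apply: (leq_trans (leq_mul IH Lb)).
rewrite -/A -/b expnS -/L.
have -> : #[b]%g ^ N * ((A * H) * (A * H) ^ k) * #[a]%g ^ N =
    #[a]%g ^ N * (A * H) ^ k * (#[b]%g ^ N * (A * H)).
  set u := #[a]%g ^ N; set v := (A * H) ^ k; set w := #[b]%g ^ N.
  lia.
by rewrite !leq_mul.
Qed.

End GroupOrders.

(** * Small orders modulo a prime and multiplicative relations *)

Section PrimeField.
Local Open Scope nat_scope.

(** H is the lcm of the orders of the q_i modulo p.  With s = t.+2, the product
    found above has s-th power of order at most p ^ t, so that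
    H ^ (s * s) <= (p ^ t) ^ s * (A H) ^ s; the s-th root and H <= p give the
    bound. *)
Lemma exists_group_exponent (q : nat -> nat) (t p : nat) :
  let N := t.+2 * t.+2 in
  prime p -> (forall i, i < t.+2 -> ~~ (p %| q i)) ->
  (forall a, 0 < a <= (\prod_(i < t.+2) q i) ^ N -> ~~ (p %| a) ->
     mult_order p a ^ t.+2 <= p ^ t) ->
  exists H, [/\ 0 < H, H ^ t.+2 <= (\prod_(j < N) j`!) * p ^ t.+1 &
    forall i, i < t.+2 -> ((q i)%:R ^+ H = 1 :> 'F_p)%R].
Proof.
move=> N pp pq small.
pose u i := insubd (1%g : {unit 'F_p}) ((q i)%:R%R : 'F_p).
have natF_eq0 a : ((a%:R : 'F_p) == 0)%R = (p %| a).
  by rewrite -(dvdn_pcharf (pchar_Fp pp)).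
have uE i : i < t.+2 -> val (u i) = (q i)%:R%R :> 'F_p.
  by move=> it; rewrite val_insubd unitfE natF_eq0 pq.
have cu (g h : {unit 'F_p}) : commute g h by apply: val_inj; apply: mulrC.
have N0 : 0 < N by [].
have [e eN] := @exists_order_prodg _ u N t.+2 cu N0.
set H := \big[lcmn/1]_(i < t.+2) _; set b := (\prod_(i < t.+2) _)%g => Hb.
have H0 : 0 < H.
  by apply: (big_ind (fun m => 0 < m)) => // x y; rewrite lcmn_gt0 => -> ->.
have Hi i : i < t.+2 -> #[u i]%g %| H.
  by move=> it; rewrite /H (bigD1 (Ordinal it)) //= dvdn_lcml.
have Hp : H <= p.
  rewrite -[leqRHS](card_Fp pp); apply: (@leq_trans #|[set: {unit 'F_p}]%G|).
    apply: dvdn_leq; first by rewrite cardG_gt0.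
    apply/dvdn_biglcmP => i _.
    by apply: (@order_dvdG _ [set: {unit 'F_p}]%G); rewrite inE.
  by rewrite cardsT card_sub max_card.
exists H; split=> //; last first.
  move=> i it; rewrite -uE // -FinRing.val_unitX.
  by have /eqP -> : (u i ^+ H == 1)%g by rewrite -order_dvdn Hi.
pose a := \prod_(i < t.+2) q i ^ e i.
have bE : val b = a%:R%R :> 'F_p.
  rewrite /b /a natr_prod -[RHS]mul1r.
  rewrite (big_morph (fun x : {unit 'F_p} => val x) (id1 := 1%R) (op1 := *%R)) //.
  rewrite mul1r; apply: eq_bigr => i _.
  by rewrite FinRing.val_unitX uE // natrX.
have pa : ~~ (p %| a).
  by rewrite -natF_eq0 -bE -unitfE; apply: valP.
have oE : mult_order p a = #[b]%g.
  rewrite /mult_order; congr #[_]%g; apply: val_inj.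
  by rewrite val_insubd -bE (valP b).
have a_bound : 0 < a <= (\prod_(i < t.+2) q i) ^ N.
  have q0 i : i < t.+2 -> 0 < q i by move=> /pq; case: (q i) => //; rewrite dvdn0.
  apply/andP; split; first by rewrite prodn_gt0 // => i; rewrite expn_gt0 q0.
  rewrite (big_morph (expn^~ N) (fun x y => expnMn x y N) (exp1n N)).
  apply: leq_prod => i _.
  by apply: leq_pexp2l; [exact: q0 | apply: ltnW].
have := small _ a_bound pa; rewrite oE => ob.
set A := \prod_(j < N) j`! in Hb *.
have : H ^ t.+2 <= #[b]%g ^ t.+2 * (A * H).
  by rewrite -(@leq_exp2r _ _ t.+2) // expnMn -!expnM.
move=> /leq_trans; apply.
apply: (leq_trans (leq_mul ob (leq_mul (leqnn A) Hp))).
by rewrite expnS; lia.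
Qed.

Lemma expn2_size_primes_leq (n : nat) : 0 < n -> 2 ^ size (primes n) <= n.
Proof.
move=> n0; rewrite [leqRHS](prod_prime_decomp n0) prime_decompE big_map /=.
rewrite -sum1_size expn_sum big_seq [leqRHS]big_seq.
apply: leq_prod => p pn; move: (pn); rewrite mem_primes => /and3P[pp _ _].
apply: leq_trans (prime_gt1 pp) _.
rewrite -{1}[p]expn1; apply: leq_pexp2l; first exact: prime_gt0.
by rewrite logn_gt0.
Qed.

(** The entries of z are exponents shifted by m, so that they range over -m to
    m - 1: up to sign, the value is the numerator minus the denominator of the
    rational number prod q_i ^ (z_i - m).  One of the two truncated differences
    is zero, and the sum is the distance between X and Y. *)
Definition relator (q : nat -> nat) {s m : nat} (z : {ffun 'I_s -> 'I_(m + m)}) : nat :=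
  let X := \prod_(i < s) q i ^ (z i - m) in
  let Y := \prod_(i < s) q i ^ (m - z i) in (X - Y) + (Y - X).

(** All products of the q_i are roots of 'X^H - 1 in a field, hence there are at
    most H of them modulo p; with m ^ s > H exponent vectors, two vectors u and w
    give the same product, and z = u - w. *)
Lemma exists_dvdn_relator (q : nat -> nat) (s m p H : nat) :
  prime p -> 0 < H -> H < m ^ s -> (forall i, i < s -> ~~ (p %| q i)) ->
  (forall i, i < s -> ((q i)%:R ^+ H = 1 :> 'F_p)%R) ->
  exists2 z : {ffun 'I_s -> 'I_(m + m)}, p %| relator q z & exists i, z i != m :> nat.
Proof.
move=> pp H0 Hm pq qH.
pose f (u : {ffun 'I_s -> 'I_m}) : 'F_p := (\prod_(i < s) (q i)%:R ^+ u i)%R.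
have natF_eq0 a : ((a%:R : 'F_p) == 0)%R = (p %| a).
  by rewrite -(dvdn_pcharf (pchar_Fp pp)).
pose T := {ffun 'I_s -> 'I_m}.
have [u [w uw fuw]] : exists u : T, exists2 w : T, u != w & f u = f w.
  apply/injectivePn/negP => /injectiveP finj.
  have: size (codom f) <= H.
    apply: max_unity_roots => //; last by rewrite map_inj_uniq ?enum_uniq.
    apply/allP => _ /codomP[u ->]; apply/unity_rootP.
    rewrite /f -prodrXl big1 // => i _.
    by rewrite exprAC qH // expr1n.
  by rewrite size_codom card_ffun !card_ord leqNgt Hm.
have ltz i : u i + (m - w i) < m + m.
  by have := ltn_ord (u i); have := ltn_ord (w i); lia.
exists [ffun i => Ordinal (ltz i)]; last first.
  have /existsP[i ui] : [exists i, u i != w i].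
    rewrite -negb_forall; apply: contraNN uw => /forallP uw.
    by apply/eqP/ffunP => i; apply/eqP.
  exists i; rewrite ffunE /=; apply: contraNN ui => /eqP ui; apply/eqP/val_inj.
  by have /= := ltn_ord (w i); move: ui => /=; lia.
set X := \prod_(i < s) q i ^ (u i - w i); set Y := \prod_(i < s) q i ^ (w i - u i).
have -> : relator q [ffun i => Ordinal (ltz i)] = (X - Y) + (Y - X).
  have EX : X = \prod_(i < s) q i ^ ([ffun i => Ordinal (ltz i)] i - m).
    apply: eq_bigr => i _; rewrite ffunE /=; congr (_ ^ _).
    by have := ltn_ord (w i); lia.
  have EY : Y = \prod_(i < s) q i ^ (m - [ffun i => Ordinal (ltz i)] i).
    apply: eq_bigr => i _; rewrite ffunE /=; congr (_ ^ _).
    by have := ltn_ord (w i); lia.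
  by rewrite /relator -EX -EY.
have XY : (X%:R = Y%:R :> 'F_p)%R.
  (* X Z and Y Z are the products attached to u and w *)
  pose Z := \prod_(i < s) q i ^ minn (u i) (w i).
  have Z0 : (Z%:R != 0 :> 'F_p)%R.
    rewrite natr_prod; apply/prodf_neq0 => i _.
    by rewrite natrX expf_neq0 // natF_eq0 pq.
  apply: (mulIf Z0); rewrite -!natrM -!big_split /=.
  transitivity (f u); [|rewrite fuw]; rewrite natr_prod; apply: eq_bigr => i _;
    rewrite -natrX -expnD; congr (_ ^ _)%:R%R; lia.
rewrite -natF_eq0 natrD.
have [le|/ltnW le] := leqP X Y; rewrite (eqP le) natrB // XY subrr.
  by rewrite add0r.
by rewrite addr0.
Qed.

(** Unique factorization: the q_i are multiplicatively independent. *)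
Lemma relator_gt0 (q : nat -> nat) {s m : nat} (z : {ffun 'I_s -> 'I_(m + m)}) (i : 'I_s) :
  (forall i, prime (q i)) -> injective q -> z i != m :> nat -> 0 < relator q z.
Proof.
move=> pq qinj zi; rewrite /relator.
set X := \prod_(i < s) _; set Y := \prod_(i < s) _.
rewrite lt0n addn_eq0 !subn_eq0 -eqn_leq; apply: contraNN zi => /eqP XY.
have logn_prod (c : 'I_s -> nat) : logn (q i) (\prod_(j < s) q j ^ c j) = c i.
  suff [_ ->] : 0 < \prod_(j < s) q j ^ c j /\
      logn (q i) (\prod_(j < s) q j ^ c j) = \sum_(j < s | j == i) c j.
    by rewrite big_pred1_eq.
  rewrite [in X in _ = X]big_mkcond /=.
  apply: (big_ind2 (fun x y => 0 < x /\ logn (q i) x = y)).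
  - by rewrite logn1.
  - by move=> x y x' y' [x0 <-] [x0' <-]; rewrite muln_gt0 x0 x0' lognM.
  move=> j _; rewrite expn_gt0 prime_gt0 // lognX logn_prime //.
  rewrite (inj_eq qinj) val_eqE [i == j]eq_sym.
  by case: (j == i); rewrite ?muln1 ?muln0.
have := congr1 (logn (q i)) XY; rewrite !logn_prod => zm.
by apply/eqP; move: zm; lia.
Qed.

Lemma size_primes_relator (q : nat -> nat) {s m : nat} (z : {ffun 'I_s -> 'I_(m + m)}) :
  (forall i, 0 < q i) ->
  0 < m -> size (primes (relator q z)) <= (\prod_(i < s) q i) * m.
Proof.
move=> q0 m0; have [->//|R0] := posnP (relator q z).
set Q := \prod_(i < s) q i.
have bound (c : 'I_s -> nat) : (forall i, c i <= m) ->
    0 < \prod_(i < s) q i ^ c i <= 2 ^ (Q * m).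
  move=> cm; apply/andP; split; first by rewrite prodn_gt0 // => i; rewrite expn_gt0 q0.
  apply: (@leq_trans (Q ^ m)); last first.
    rewrite expnM; case: m m0 {z R0 cm} => // m _.
    by rewrite leq_exp2r // ltnW // ltn_expl.
  rewrite (big_morph (expn^~ m) (fun x y => expnMn x y m) (exp1n m)).
  by apply: leq_prod => j _; apply: leq_pexp2l; rewrite ?q0.
rewrite -(@leq_exp2l 2) //; apply: leq_trans (expn2_size_primes_leq _ R0) _.
have := bound (fun i => z i - m); have := bound (fun i => m - z i).
rewrite /relator; set X := \prod_(i < s) _; set Y := \prod_(i < s) _.
move=> /(_ (fun i => leq_subr _ _)) bX.
have zm i : z i - m <= m by have := ltn_ord (z i); lia.
by move=> /(_ zm) bY; lia.
Qed.

(** Each exceptional prime below y ^ N divides a nonzero relator of height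
    m = O(y ^ (s - 1)), where s = t.+2; the relators are (2 m) ^ s in number with
    O(m) prime divisors each, and (s - 1) (s + 1) = N - 1. *)
Lemma card_small_orders (q : nat -> nat) (t : nat) :
  (forall i, prime (q i)) -> injective q ->
  let N := t.+2 * t.+2 in
  exists C, forall (y : nat) (ps : seq nat), 0 < y -> uniq ps ->
  {in ps, forall p, [/\ prime p, p < y ^ N, forall i, i < t.+2 -> ~~ (p %| q i) &
     forall a, 0 < a <= (\prod_(i < t.+2) q i) ^ N -> ~~ (p %| a) ->
       mult_order p a ^ t.+2 <= p ^ t]} ->
  size ps <= C * y ^ N.-1.
Proof.
move=> pq qinj N; pose A := \prod_(j < N) j`!; pose Q := \prod_(i < t.+2) q i.
have A0 : 0 < A by rewrite prodn_gt0 // => i; rewrite fact_gt0.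
(* (m + m) ^ t.+2 relators, at most Q * m prime divisors each *)
exists ((4 * A) ^ t.+2 * (Q * (2 * A))) => y ps y0 ps_uniq Hps.
pose m := 2 * A * y ^ t.+1.
pose Z := {ffun 'I_t.+2 -> 'I_(m + m)}.
have ps_sub : {subset ps <= flatten [seq primes (relator q z) | z <- enum {: Z}]}.
  move=> p /Hps[pp pN p_q small].
  have [H [H0 HA qH]] := exists_group_exponent _ _ _ pp p_q small.
  have HAy : H <= A * y ^ (t.+2 * t.+1).
    rewrite -(@leq_exp2r _ _ t.+2) //; apply: leq_trans HA _.
    rewrite expnMn -expnM; apply: leq_mul.
      exact: (@leq_pexp2l A 1).
    apply: (@leq_trans ((y ^ N) ^ t.+1)); first by rewrite leq_exp2r // ltnW.
    by rewrite -expnM leq_eqVlt; apply/orP; left; apply/eqP; congr (_ ^ _); lia.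
  have Hm : H < m ^ t.+2.
    apply: leq_ltn_trans HAy _; rewrite /m expnMn -expnM mulnC [t.+1 * _]mulnC.
    rewrite [ltnRHS]mulnC ltn_pmul2l ?expn_gt0 ?y0 //.
    apply: (@leq_trans (2 * A)); first by lia.
    by apply: (@leq_pexp2l (2 * A) 1); lia.
  have [z pz [i zi]] := exists_dvdn_relator _ _ _ _ _ pp H0 Hm p_q qH.
  apply/flattenP; exists (primes (relator q z)).
    by apply/mapP; exists z; rewrite ?mem_enum.
  by rewrite mem_primes pp pz (relator_gt0 _ _ i).
apply: leq_trans (uniq_leq_size ps_uniq ps_sub) _.
rewrite size_flatten /shape -map_comp sumnE big_map big_enum /=.
apply: (@leq_trans (\sum_(z : Z) Q * m)).
  apply: leq_sum => z _; apply: size_primes_relator.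
    by move=> i; apply: prime_gt0.
  by rewrite !muln_gt0 A0 expn_gt0 y0.
rewrite sum_nat_const card_ffun !card_ord.
have -> : m + m = 4 * A * y ^ t.+1 by rewrite /m; lia.
rewrite expnMn -expnM /m.
have -> : y ^ N.-1 = y ^ (t.+1 * t.+2) * y ^ t.+1.
  by rewrite -expnD; congr (_ ^ _); rewrite /N; lia.
set u := y ^ _; set v := y ^ _; set w := _ ^ _.
by rewrite leq_eqVlt; apply/orP; left; apply/eqP; lia.
Qed.

End PrimeField.

(** * Passage to the density statement *)

Section Density.

Lemma exists_primes_injective : exists2 q : nat -> nat, forall i, prime (q i) & injective q.
Proof.
pose next m := s2val (prime_above m); pose q n := iter n next 2%N.
have qS i : (q i < q i.+1)%N by rewrite /q /= /next; case: prime_above.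
exists q => [[|i]//|]; first by rewrite /q /= /next; case: prime_above.
have q_mono := homo_ltn ltn_trans qS.
by move=> i j; case: (ltngtP i j) => // /q_mono /[swap] ->; rewrite ltnn.
Qed.

(** With w = x ^ (1 / (2 N)), the choice y = floor(w ^ 2) + 1 makes the bound
    O(w ^ (2 N - 2)), while ln x = 2 N ln w <= 2 N w shows that x / ln x is at
    least w ^ (2 N - 1) / (2 N). *)
Lemma littleo_of_power_saving (R : realType) (f : R -> nat) (N P C : nat) :
  (0 < N)%N ->
  (forall (x : R) (y : nat), 1 < x -> (0 < y)%N -> x < y%:R ^+ N ->
     (f x <= P + C * y ^ N.-1)%N) ->
  (fun x : R => (f x)%:R : R) =o_+oo (fun x : R => x / ln x).
Proof.
move=> N0 fP; apply/eqoP => d d0.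
(* the factor 2 accounts for the rounding y <= 2 * w ^+ 2 *)
pose K : R := (P + C * 2 ^ N.-1)%:R.
pose M : R := (N * 2)%:R.
have M0 : 0 < M by rewrite ltr0n muln_gt0 N0.
have K0 : 0 <= K by rewrite ler0n.
pose W : R := M * K / d + 1.
have W1 : 1 <= W by rewrite /W lerDr divr_ge0 ?mulr_ge0 // ltW.
exists (W ^+ (N * 2)); split; first by rewrite realE exprn_ge0 // (le_trans _ W1).
move=> x Wx.
have x1 : 1 < x by apply: le_lt_trans Wx; rewrite exprn_ege1.
have x0 : 0 < x by apply: lt_trans x1.
pose w := x `^ (M^-1).
have w0 : 0 < w by rewrite powR_gt0.
have wx : w ^+ (N * 2) = x.
  by rewrite -powR_mulrn ?powR_ge0 // /w -powRrM mulVf ?powRr1 ?ltW // gt_eqF.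
clearbody w; have Ww : W < w.
  rewrite ltNge; apply/negP => wW; move: Wx; rewrite -{1}wx ltNge lerXn2r //.
    by rewrite nnegrE ltW.
  by rewrite nnegrE (le_trans _ W1).
have w1 : 1 <= w by rewrite ltW // (le_lt_trans W1).
pose y := (Num.truncn (w ^+ 2)).+1.
have ylo : w ^+ 2 < y%:R by rewrite truncnS_gt.
have w21 : 1 <= w ^+ 2 by rewrite exprn_ege1.
have yhi : y%:R <= 2 * w ^+ 2.
  rewrite /y -natr1 mulr_natl mulr2n lerD //.
  by rewrite truncn_le // (le_trans _ w21).
have xy : x < y%:R ^+ N.
  rewrite -wx mulnC exprM ltrXn2r -?lt0n ?gtn_eqF //.
  by rewrite exprn_ge0 // ltW.
have lnx0 : 0 < ln x by rewrite ln_gt0.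
have lnx : ln x <= M * w.
  rewrite -wx lnXn // -mulr_natl ler_pM2l //; apply: ltW; exact: ln_sublinear.
have fx : (f x)%:R <= K * w ^+ (N.-1 * 2).
  apply: (@le_trans _ _ (P + C * y ^ N.-1)%:R).
    by rewrite ler_nat fP.
  rewrite /K !natrD mulrDl !natrM !natrX lerD //.
    by rewrite ler_peMr // exprn_ege1.
  rewrite -mulrA ler_wpM2l // mulnC exprM -exprMn lerXn2r // nnegrE //.
  by rewrite mulr_ge0 // exprn_ge0 // ltW.
rewrite normr_nat ger0_norm ?divr_ge0 ?(ltW x0) ?(ltW lnx0) //.
apply: le_trans fx _; rewrite mulrA ler_pdivlMr //.
apply: (@le_trans _ _ (K * w ^+ (N.-1 * 2) * (M * w))).
  by rewrite ler_wpM2l // mulr_ge0 // exprn_ge0 // ltW.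
have -> : d * x = w ^+ (N.-1 * 2) * w * (d * w).
  have {1}<- : w ^+ (N.-1 * 2) * w * w = x.
    rewrite -wx.
    have E : (N * 2 = (N.-1 * 2).+2)%N.
      by rewrite -{1}(prednK N0) mulSn.
    by rewrite E 2!exprSr.
  ring.
have -> : K * w ^+ (N.-1 * 2) * (M * w) = w ^+ (N.-1 * 2) * w * (M * K) by ring.
rewrite ler_wpM2l // ?mulr_ge0 ?exprn_ge0 ?(ltW w0) //.
rewrite -ler_pdivrMl //; apply: ltW; apply: lt_trans Ww.
by rewrite /W mulrC ltrDl.
Qed.

End Density.

Theorem mainTheorem5 (R : realType) (xi : R -> R)
    (xi_infty : xi x @[x --> +oo] --> +oo)
    (epsilon : R) (epsilon_gt0 : 0 < epsilon) :
  almost_all_primes R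
    (fun p : nat => p%:R `^ (1 - epsilon) < (max_order (xi p%:R) p)%:R).
Proof.
have [q pq qinj] := exists_primes_injective.
(* p ^ (1 - epsilon) is at most p ^ (t / t.+2) as soon as 2 <= t.+2 * epsilon *)
pose t := Num.truncn (2 / epsilon).
have te : 2 <= t.+2%:R * epsilon.
  rewrite -ler_pdivrMr // ltW // (lt_trans (truncnS_gt _)) //.
  by rewrite ltr_nat.
pose N := (t.+2 * t.+2)%N; pose Q := (\prod_(i < t.+2) q i)%N.
have [C HC] := card_small_orders q t pq qinj.
have [M [Mreal HM]] : \forall x \near +oo, (Q ^ N)%:R <= xi x.
  by move/cvgryPge: xi_infty; apply.
(* from P on, xi p is at least Q ^ N, and p exceeds the t.+2 chosen primes *)
pose P := maxn (Num.truncn M).+1 Q.+1.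
apply: (@littleo_of_power_saving R _ N P C) => // x y x1 y0 xy.
pose good (p : nat) := p%:R `^ (1 - epsilon) < (max_order (xi p%:R) p)%:R.
pose b p := prime p && ~~ good p.
have -> : exceptions good x = size [seq p <- iota 0 (Num.truncn x).+1 | b p].
  transitivity (\sum_(0 <= p < (Num.truncn x).+1 | b p) 1)%N.
    by rewrite big_mkord.
  by rewrite sum1_count /index_iota subn0 size_filter.
pose ps := [seq p <- iota 0 (Num.truncn x).+1 | b p && (P <= p)%N].
have ps_uniq : uniq ps by rewrite filter_uniq // iota_uniq.
apply: (@leq_trans (size (iota 0 P ++ ps))).
  apply: uniq_leq_size; first by rewrite filter_uniq // iota_uniq.
  move=> p; rewrite mem_cat !mem_filter !mem_iota /= => /andP[-> ->].
  by rewrite andbT /= ltnNge; case: (P <= p)%N.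
rewrite size_cat size_iota leq_add2l; apply: HC => // p.
rewrite mem_filter mem_iota /= add0n ltnS => /andP[/andP[/andP[pp small] Pp] px].
have p0 := prime_gt0 pp.
have q_p i : (i < t.+2)%N -> ~~ (p %| q i)%N.
  move=> it; apply/negP => /(dvdn_leq (prime_gt0 (pq i))).
  rewrite leqNgt => /negP; apply; apply: leq_trans Pp.
  rewrite leq_max; apply/orP; right; rewrite ltnS; apply: dvdn_leq.
    by rewrite prodn_gt0 // => j; rewrite prime_gt0.
  by rewrite /Q (bigD1 (Ordinal it)) //= dvdn_mulr.
have xiB : (Q ^ N)%:R <= xi p%:R.
  apply: HM; apply: lt_le_trans (truncnS_gt M) _; rewrite ler_nat.
  by apply: leq_trans Pp; rewrite leq_maxl.
split=> // [|a /andP[a0 aB] pa].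
  rewrite -(ltr_nat R) natrX; apply: le_lt_trans xy.
  by rewrite -truncn_ge_nat // ltW // (lt_trans _ x1).
have ord_max : (mult_order p a <= max_order (xi p%:R) p)%N.
  rewrite /max_order; apply: leq_bigmax_seq => //.
  rewrite mem_index_iota a0 ltnS.
  have B0 : 0 <= xi p%:R by rewrite (le_trans _ xiB).
  by rewrite truncn_ge_nat // (le_trans _ xiB) // ler_nat.
have p1 : 1 <= p%:R :> R by rewrite ler1n.
move: small; rewrite /good -leNgt => small.
rewrite -(ler_nat R) !natrX.
have oP : (mult_order p a)%:R <= p%:R `^ (1 - epsilon) :> R.
  by apply: le_trans small; rewrite ler_nat.
apply: (@le_trans _ _ ((p%:R `^ (1 - epsilon)) ^+ t.+2)).
  by rewrite lerXn2r ?nnegrE ?powR_ge0.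
rewrite -!powR_mulrn ?powR_ge0 // -powRrM ler_powR //.
by move: te; rewrite -addn2 natrD; nra.
Qed.
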